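(* Let $\Omega$ be a compact topological space and $\bm\varphi(x)=(\varphi_1(x),\dots,\varphi_n(x))^\top$ a vector of $n$ linearly independent continuous functions $\varphi_k\colon\Omega\to\mathbb{C}$. Let $N=\dim_{\mathbb{C}}(\operatorname{span}_{\mathbb{C}}\{\varphi_k\overline{\varphi_l}\}_{k,l=1}^n)$ and $\mathcal{M}=\{\bm\varphi(x)\bm\varphi(x)^* : x\in\Omega\}\subset\mathbb{C}^{n\times n}$. Then there exist points $x_1,\dots,x_{N+1}\in\Omega$ and weights $\lambda_1,\dots,\lambda_{N+1}\ge0$ with $\lambda_1+\dots+\lambda_{N+1}=1$ such that $$\det\Big(\sum_{i=1}^{N+1}\lambda_i\bm\varphi(x_i)\bm\varphi(x_i)^*\Big)=\max_{\bm M\in\operatorname{conv}\mathcal{M}}\det(\bm M),$$ and for any such choice, with $\lambda=\sum_{i=1}^{N+1}\lambda_i\delta_{x_i}$, the Hermitian matrix $\bm A_\lambda=\sum_{i=1}^{N+1}\lambda_i\bm\varphi(x_i)\bm\varphi(x_i)^*$ is strictly positive definite and the new system $\bm\psi(x):=\bm A_\lambda^{-1/2}\bm\varphi(x)$ satisfies $$\sum_{i=1}^{N+1}\lambda_i|\langle\bm a,\bm\psi(x_i)\rangle|^2=\|\bm a\|_2^2\quad\text{for all }\bm a\in\mathbb{C}^n .$$ In addition, $\|\bm\psi(x)\|_2\le\sqrt n$ for all $x\in\Omega$, and $\|\bm\psi(x)\|_2=\sqrt n$ on $\operatorname{supp}\lambda$.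
   Context: $\bm y^*$ denotes the conjugate transpose; $\langle\cdot,\cdot\rangle$ and $\|\cdot\|_2$ are the standard inner product and Euclidean norm on $\mathbb{C}^n$. $\operatorname{supp}\lambda$ is the set of points $x_i$ with $\lambda_i>0$. $\operatorname{conv}$ is the convex hull. *)

(* Defs.v *)
From HB Require Import structures.
From mathcomp Require Import all_boot all_order all_algebra.
From mathcomp Require Import complex.
From mathcomp Require Import all_classical all_reals all_analysis.

Set Implicit Arguments.
Unset Strict Implicit.
Unset Printing Implicit Defensive.

Import Order.TTheory GRing.Theory Num.Theory.
Import numFieldNormedType.Exports.
Local Open Scope classical_set_scope.
Local Open Scope ring_scope.

(* Packaging R[i] as a numClosedFieldType gives it the norm topology that
   MathComp-Analysis attaches to every numClosedFieldType. *)
Definition Cplx (R : realType) : numClosedFieldType := R[i]%C.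

Section LinearAlgebra.
Variables (C : numClosedFieldType) (V : lmodType C).

Definition lin_indep (I : finType) (f : I -> V) : Prop :=
  forall c : I -> C, \sum_i c i *: f i = 0 -> forall i, c i = 0.

Definition lin_span (I : finType) (f : I -> V) : set V :=
  [set v | exists c : I -> C, v = \sum_i c i *: f i].

Definition has_dim (S : set V) (d : nat) : Prop :=
  exists e : 'I_d -> V, lin_indep e /\ lin_span e = S.

(* Over C, the coefficients of convex_set are the t : C with 0 <= t <= 1, which
   forces t to be real: this is the convex hull over the reals. *)
Definition conv_hull (A : set V) : set V := smallest (@convex_set C V) A.

End LinearAlgebra.

Section Hermitian.
Variables (C : numClosedFieldType) (n : nat).

(* dotmx is the library's inner product on row vectors. *)
Definition inner (u v : 'cV[C]_n) : C := dotmx u^T v^T.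

Definition norm2 (u : 'cV[C]_n) : C := sqrtC (inner u u).

Definition posdefmx (A : 'M[C]_n) : Prop :=
  A \is hermsymmx /\ forall a : 'cV[C]_n, a != 0 -> 0 < inner (A *m a) a.

(* A^{-1/2} by functional calculus on the unitary diagonalization
   A = P^-1 *m diag_mx d *m P of spectral.v; meaningful for A positive definite,
   where it is the unique positive definite B with B *m B = A^-1. *)
Definition invsqrtmx (A : 'M[C]_n) : 'M[C]_n :=
  invmx (spectralmx A) *m
  diag_mx (map_mx (fun t => (sqrtC t)^-1) (spectral_diag A)) *m spectralmx A.

End Hermitian.

(* The order of C makes f t <= m include that m - f t is real. *)
Definition is_max (C : numClosedFieldType) (T : Type) (f : T -> C) (D : set T)
    (m : C) : Prop :=
  (exists2 t, D t & f t = m) /\ forall t, D t -> f t <= m.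

Section Frame.
Variables (R : realType) (Omega : Type) (n : nat) (phi : 'I_n -> Omega -> Cplx R).
Local Notation C := (Cplx R).

Definition phivec (x : Omega) : 'cV[C]_n := \col_k phi k x.

Definition rank1 (x : Omega) : 'M[C]_n := phivec x *m (phivec x)^t*%sesqui.

Definition prob_weights (m : nat) (lam : 'I_m -> R) : Prop :=
  (forall i, 0 <= lam i) /\ \sum_i lam i = 1.

Definition supp (m : nat) (x : 'I_m -> Omega) (lam : 'I_m -> R) : set Omega :=
  [set x i | i in [set i | 0 < lam i]].

Definition Amx (m : nat) (x : 'I_m -> Omega) (lam : 'I_m -> R) : 'M[C]_n :=
  \sum_i (lam i)%:C%C *: rank1 (x i).

Definition psi (m : nat) (x : 'I_m -> Omega) (lam : 'I_m -> R) (y : Omega) :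
    'cV[C]_n :=
  invsqrtmx (Amx x lam) *m phivec y.

End Frame.

(* Main.v *)
Require Import Defs.
From HB Require Import structures.
From mathcomp Require Import all_boot all_order all_algebra.
From mathcomp Require Import complex lra.
From mathcomp Require Import all_classical all_reals all_analysis.

Import Order.TTheory GRing.Theory Num.Theory.
Import numFieldNormedType.Exports.
Local Open Scope classical_set_scope.
Local Open Scope ring_scope.

(** Every matrix of the convex hull is a weighted sum A(x, lambda) of matrices
phi(x_i) phi(x_i)^*. Since these matrices are Hermitian, a complex linear relation
between them may be replaced by its real part, so Caratheodory reduction stops at
N + 1 points although N is a complex dimension. The determinant is then a
continuous function on the compact set of N + 1 points and weights, hence attains
its maximum. As the phi_k are independent, some A(y, mu) is nonsingular, so a
maximizer A is positive semidefinite with positive determinant. For a point y put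
s(y) = |psi(y)|^2 = phi(y)^* A^-1 phi(y). The determinant lemma at the hull points
(1 - t) A + t phi(y) phi(y)^* gives (1 - t)^n (1 + t s(y) / (1 - t)) <= 1 for
0 < t < 1, whence s(y) <= n. Since the weighted mean of s over the x_i is
tr(A^-1 A) = n, equality holds on the support. *)

(** * Hermitian matrices: determinants, spectral decomposition and positivity *)

Section LinearAlgebra.
Variables (C : numClosedFieldType) (n : nat).
Local Notation "M ^H" := (M^t*%sesqui) (at level 8, format "M ^H").
Implicit Types (A B : 'M[C]_n) (u v : 'cV[C]_n).

Lemma trmxCM m p q (A : 'M[C]_(m, p)) (B : 'M[C]_(p, q)) :
  (A *m B)^H = B^H *m A^H.
Proof. by rewrite trmx_mul map_mxM. Qed.

Lemma innerE u v : inner u v = (v^H *m u) 0 0.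
Proof.
rewrite /inner dotmxE !mxE; apply: eq_bigr => i _.
by rewrite !mxE mulrC.
Qed.

Lemma norm2_sqr u : norm2 u ^+ 2 = (u^H *m u) 0 0.
Proof. by rewrite sqrtCK innerE. Qed.

Lemma inner_ge0 u : 0 <= inner u u.
Proof.
by rewrite innerE mxE sumr_ge0// => i _; rewrite !mxE mulrC mul_conjC_ge0.
Qed.

Lemma hermsymmxP A : reflect (A^H = A) (A \is hermsymmx).
Proof.
by apply: (iffP (is_hermitianmxP _ _ _)); rewrite expr0 scale1r => /esym.
Qed.

(** Conjugation by a unipotent block matrix turns a block triangular matrix with diagonal blocks
    [1 + u v] and [1] into one with diagonal blocks [1] and [1 + v u]. *)
Lemma det_1Dmulmx u (v : 'rV[C]_n) :
  \det (1%:M + u *m v) = 1 + (v *m u) 0 0.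
Proof.
have e1 : block_mx 1%:M 0 v (1%:M : 'M[C]_1) *m
          block_mx (1%:M + u *m v) u 0 1%:M *m
          block_mx 1%:M 0 (- v) 1%:M
   = block_mx 1%:M u 0 (1%:M + v *m u).
  rewrite !mulmx_block !mul1mx !mulmx1 !mul0mx !mulmx0 !addr0 !add0r.
  rewrite mulmxN addrK mulmxDr mulmx1 mulmxN mulmxA.
  by rewrite mulmxDl mul1mx [v + _]addrC subrr [1%:M + _]addrC.
have := congr1 determinant e1.
rewrite !det_mulmx !det_lblock !det_ublock !det1 !mulr1 !mul1r => ->.
by rewrite det_mx11 !mxE eqxx mulr1n.
Qed.

Lemma det_rank1_update A (c : C) u (v : 'rV[C]_n) : A \in unitmx ->
  \det (A + c *: (u *m v)) = \det A * (1 + c * (v *m invmx A *m u) 0 0).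
Proof.
move=> Au; have -> : A + c *: (u *m v) = A *m (1%:M + (c *: (invmx A *m u)) *m v).
  by rewrite mulmxDr mulmx1 -scalemxAl -scalemxAr !mulmxA mulmxV// mul1mx.
by rewrite det_mulmx det_1Dmulmx -scalemxAr mxE mulmxA.
Qed.

Local Notation U A := (spectralmx A).
Local Notation d A := (spectral_diag A).

Lemma spectralE A : A \is hermsymmx ->
  A = (U A)^H *m diag_mx (d A) *m U A.
Proof.
move=> /hermitian_normalmx/orthomx_spectralP; rewrite invmx_unitary//.
exact: spectral_unitarymx.
Qed.

Lemma spectral_adjK A : U A *m (U A)^H = 1%:M.
Proof. exact/unitarymxP/spectral_unitarymx. Qed.

Lemma spectral_Kadj A : (U A)^H *m U A = 1%:M.
Proof. by rewrite (mulmx1C (spectral_adjK A)). Qed.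

Lemma det_spectral A : A \is hermsymmx -> \det A = \prod_i d A 0 i.
Proof.
move=> /spectralE AE; rewrite {1}AE !det_mulmx det_diag mulrAC -det_mulmx.
by rewrite spectral_Kadj det1 mul1r.
Qed.

Lemma inner_spectral A u : A \is hermsymmx ->
  inner (A *m u) u = \sum_i d A 0 i * `|(U A *m u) i 0| ^+ 2.
Proof.
move=> /spectralE AE; rewrite {1}AE innerE -!mulmxA mulmxA -trmxCM.
move: (U A *m u) => w; rewrite mxE; apply: eq_bigr => i _.
by rewrite mul_diag_mx !mxE normCK mulrCA [_^* * _]mulrC.
Qed.

(** The adjoint of the spectral basis maps the i-th unit vector to a unit eigenvector, so positivity
    of the quadratic form passes to the eigenvalues. *)
Lemma spectral_eigen A i : A \is hermsymmx ->
  inner (A *m ((U A)^H *m delta_mx i 0)) ((U A)^H *m delta_mx i 0) = d A 0 i.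
Proof.
move=> Ah; rewrite inner_spectral// mulmxA spectral_adjK mul1mx.
rewrite (bigD1 i)//= big1 => [|j ji]; rewrite !mxE ?eqxx.
  by rewrite normr1 expr1n mulr1 addr0.
by rewrite (negbTE ji) normr0 expr0n mulr0.
Qed.

Lemma psd_det_ge0 A : A \is hermsymmx ->
  (forall u, 0 <= inner (A *m u) u) -> 0 <= \det A.
Proof.
move=> Ah A0; rewrite det_spectral// prodr_ge0// => i _.
by rewrite -spectral_eigen.
Qed.

(** The eigenvalues are nonnegative and their product is nonzero, so each of them is positive. *)
Lemma psd_posdefmx A : A \is hermsymmx ->
  (forall u, 0 <= inner (A *m u) u) -> \det A != 0 -> posdefmx A.
Proof.
move=> Ah A0 detA; split=> // u u0; rewrite lt_def A0 andbT.
have dgt0 i : 0 < d A 0 i.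
  rewrite lt_def -[X in _ && (_ <= X)]spectral_eigen// A0 andbT.
  by apply: contra detA => /eqP di; rewrite det_spectral// (bigD1 i)//= di mul0r.
(* If the form vanishes at [u], so does each of its nonnegative terms; the eigenvalues being
   positive, all coordinates of [u] in the eigenbasis are zero. *)
apply: contra u0; rewrite inner_spectral// psumr_eq0 => [/allP h|i _]; last first.
  by rewrite mulr_ge0// ?exprn_ge0// ltW.
suff Uu0 : U A *m u = 0 by rewrite -[u]mul1mx -(spectral_Kadj A) -mulmxA Uu0 mulmx0.
apply/colP => i; rewrite [RHS]mxE.
have /= := h i (mem_index_enum _).
by rewrite mulf_eq0 gt_eqF//= expf_eq0/= normr_eq0 => /eqP.
Qed.

(** * The inverse square root of a positive definite matrix *)

Section PosDef.
Variables (A : 'M[C]_n) (Apos : posdefmx A).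

Lemma posdef_spectral_gt0 i : 0 < d A 0 i.
Proof.
case: Apos => Ah A0; rewrite -spectral_eigen//; apply: A0.
apply/eqP => /(congr1 (mulmx (U A))); rewrite mulmxA spectral_adjK mul1mx mulmx0.
by move/matrixP/(_ i 0); rewrite !mxE !eqxx => /eqP; rewrite oner_eq0.
Qed.

Local Notation D := (diag_mx (map_mx (fun t => (sqrtC t)^-1) (d A))).

Lemma invsqrtmxE : invsqrtmx A = (U A)^H *m D *m U A.
Proof. by rewrite /invsqrtmx invmx_unitary// spectral_unitarymx. Qed.

Lemma invsqrtmx_herm : (invsqrtmx A)^H = invsqrtmx A.
Proof.
rewrite invsqrtmxE !trmxCM trmxCK mulmxA; congr (_ *m _ *m _).
rewrite tr_diag_mx map_diag_mx; congr diag_mx; apply/rowP => i; rewrite !mxE.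
by apply: geC0_conj; rewrite invr_ge0 sqrtC_ge0 ltW// posdef_spectral_gt0.
Qed.

(** All three factors are diagonal in the same orthonormal basis, so the product reduces to
    [D *m diag_mx (d A) *m D = 1], entry by entry. *)
Lemma invsqrtmxK : invsqrtmx A *m A *m invsqrtmx A = 1%:M.
Proof.
have [Ah _] := Apos; rewrite {2}(spectralE _ Ah) !invsqrtmxE -!mulmxA.
do 2! rewrite [U A *m (_^H *m _)]mulmxA spectral_adjK mul1mx.
rewrite [D *m (diag_mx _ *m _)]mulmxA.
rewrite [_ *m (D *m _)]mulmxA.
rewrite (_ : D *m diag_mx _ *m D = 1%:M) ?mul1mx ?spectral_Kadj//.
rewrite !mulmx_diag -diag_const_mx; congr diag_mx; apply/rowP => i.
rewrite !mxE mulrC mulrA -invfM -expr2 sqrtCK mulVf//.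
by rewrite gt_eqF// posdef_spectral_gt0.
Qed.

Lemma posdef_unitmx : A \in unitmx.
Proof. by have /mulmx1_unit[] := invsqrtmxK; rewrite unitmx_mul => /andP[]. Qed.

Lemma invsqrtmx_sqr : invsqrtmx A *m invsqrtmx A = invmx A.
Proof.
have /mulmx1C/(congr1 (mulmxr (invmx A)))/= := invsqrtmxK.
by rewrite mul1mx !mulmxA (mulmxK posdef_unitmx).
Qed.

Lemma inner_invsqrtmx u :
  inner (A *m (invsqrtmx A *m u)) (invsqrtmx A *m u) = norm2 u ^+ 2.
Proof.
rewrite innerE norm2_sqr trmxCM invsqrtmx_herm.
by rewrite -[X in _ = (_ *m X) 0 0]mul1mx -invsqrtmxK !mulmxA.
Qed.

Lemma norm2_invsqrt_sqr u :
  norm2 (invsqrtmx A *m u) ^+ 2 = (u^H *m invmx A *m u) 0 0.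
Proof.
by rewrite norm2_sqr trmxCM invsqrtmx_herm -invsqrtmx_sqr !mulmxA.
Qed.

End PosDef.
End LinearAlgebra.

(** * Finite averages in convex sets *)

(** Leaving the weights unnormalized lets the induction drop the last point. The average is then a
    two-point combination of the average of the first [m] points, with parameter [S / (S + a)], and
    the last point. *)
Lemma convex_set_sum (C : numClosedFieldType) (V : lmodType C) (A : set V)
    (m : nat) (f : 'I_m -> V) (l : 'I_m -> C) :
  @convex_set C V A -> (forall i, A (f i)) -> (forall i, 0 <= l i) ->
  0 < \sum_i l i -> A ((\sum_i l i)^-1 *: \sum_i l i *: f i).
Proof.
move=> cA; elim: m f l => [|m IH] f l Af l0; first by rewrite big_ord0 ltxx.
rewrite !big_ord_recr/=.
set S := \sum_(i < m) l _; set v := \sum_(i < m) _; set a := l ord_max.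
have a0 : 0 <= a by exact: l0.
have S0 : 0 <= S by apply: sumr_ge0.
have [Se0|Sne0] := eqVneq S 0 => Sa0.
  (* The first [m] weights all vanish, so the average is the last point. *)
  have -> : v = 0.
    apply: big1 => i _; move/eqP: Se0; rewrite psumr_eq0// => /allP/(_ i).
    by rewrite mem_index_enum => /(_ isT)/= /eqP ->; rewrite scale0r.
  rewrite Se0 !add0r scalerA mulVf ?scale1r//.
  by move: Sa0; rewrite Se0 add0r => /gt_eqF ->.
have Spos : 0 < S by rewrite lt_def Sne0.
have t0 : 0 <= S / (S + a) by rewrite divr_ge0// ltW.
have t1 : S / (S + a) <= 1 by rewrite ler_pdivrMr// mul1r lerDl.
have /mem_set h1 := IH (fun i => f (widen_ord (leqnSn m) i))
  (fun i => l (widen_ord (leqnSn m) i)) (fun i => Af _) (fun i => l0 _) Spos.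
have /mem_set h2 := Af ord_max.
have /set_mem := cA _ _ (Itv01 t0 t1) h1 h2.
congr A; rewrite /conv/= scalerA scalerDr; congr (_ + _).
  by rewrite mulrC mulrA mulVf// mul1r.
rewrite scalerA; congr (_ *: _); rewrite mulrC /unstable.onem.
by rewrite -[1](mulVf (lt0r_neq0 Sa0)) -mulrBr addrAC subrr add0r.
Qed.

(** * Weighted averages of rank-one matrices and the convex hull *)

Section RankOneAverages.
Variables (R : realType) (Omega : Type) (n : nat) (phi : 'I_n -> Omega -> Cplx R).
Local Notation C := (Cplx R).
Local Notation "M ^H" := (M^t*%sesqui) (at level 8, format "M ^H").

Lemma real_complex_ge0 (a : R) : (0 <= (a%:C%C : C)) = (0 <= a).
Proof. exact: ler0c. Qed.

Lemma sum_real_complex (m : nat) (a : 'I_m -> R) :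
  \sum_i ((a i)%:C%C : C) = (\sum_i a i)%:C%C.
Proof. by rewrite [RHS](rmorph_sum (real_complex R)). Qed.

Lemma rank1_adj x : (rank1 phi x)^H = rank1 phi x.
Proof. by rewrite trmxCM trmxCK. Qed.

Lemma Amx_adj m (x : 'I_m -> Omega) (lam : 'I_m -> R) :
  (Amx phi x lam)^H = Amx phi x lam.
Proof.
rewrite /Amx linear_sum/= (raddf_sum (map_mx _))/=; apply: eq_bigr => i _.
rewrite linearZ/= map_mxZ -[in RHS]rank1_adj; congr (_ *: _).
exact: conjc_real.
Qed.

Lemma Amx_herm m (x : 'I_m -> Omega) (lam : 'I_m -> R) :
  Amx phi x lam \is hermsymmx.
Proof. exact/hermsymmxP/Amx_adj. Qed.

Lemma inner_rank1 x (a : 'cV[C]_n) :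
  inner (rank1 phi x *m a) a = `|inner a (phivec phi x)| ^+ 2.
Proof.
have e : (a^H *m phivec phi x) 0 0 = (inner a (phivec phi x))^*.
  by rewrite innerE -[in LHS](trmxCK (_ *m phivec phi x)) trmxCM trmxCK 2!mxE.
by rewrite innerE /rank1 -!mulmxA mulmxA mxE big_ord1 e normCK mulrC innerE.
Qed.

(** This formula yields both the semidefiniteness of the averages and, later, the frame identity. *)
Lemma inner_Amx m (x : 'I_m -> Omega) (lam : 'I_m -> R) (a : 'cV[C]_n) :
  inner (Amx phi x lam *m a) a =
  \sum_i (lam i)%:C%C * `|inner a (phivec phi (x i))| ^+ 2.
Proof.
rewrite innerE mulmx_suml mulmx_sumr summxE; apply: eq_bigr => i _.
by rewrite -scalemxAl -scalemxAr mxE -innerE inner_rank1.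
Qed.

Lemma Amx_psd m (x : 'I_m -> Omega) (lam : 'I_m -> R) (a : 'cV[C]_n) :
  (forall i, 0 <= lam i) -> 0 <= inner (Amx phi x lam *m a) a.
Proof.
move=> l0; rewrite inner_Amx sumr_ge0// => i _.
by rewrite mulr_ge0 ?real_complex_ge0// exprn_ge0.
Qed.

(** The averages form a convex set containing every rank-one matrix, which gives the forward
    direction; the converse is [convex_set_sum]. *)
Lemma conv_hull_rank1P (M : 'M[C]_n) :
  conv_hull (range (rank1 phi)) M <->
  exists m (x : 'I_m -> Omega) (lam : 'I_m -> R),
    prob_weights lam /\ M = Amx phi x lam.
Proof.
split; last first.
  move=> [m [x [lam [[l0 l1] ->]]]] A [cA rA].
  have sl : \sum_i ((lam i)%:C%C : C) = 1 by rewrite sum_real_complex l1.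
  have := @convex_set_sum C _ A m (rank1 phi \o x) (fun i => (lam i)%:C%C) cA.
  rewrite sl invr1 scale1r; apply => // i; last by rewrite real_complex_ge0.
  by apply: rA; exists (x i).
pose A := [set M : 'M[C]_n | exists m (x : 'I_m -> Omega) (lam : 'I_m -> R),
    prob_weights lam /\ M = Amx phi x lam].
apply: (@smallest_sub _ (@convex_set C _) (range (rank1 phi)) A); last first.
  move=> _ [x _ <-]; exists 1%N, (fun=> x), (fun=> 1); split.
    by split=> //; rewrite big_ord1.
  by rewrite /Amx big_ord1 scale1r.
move=> _ _ t /set_mem[m1 [x1 [l1 [[l10 l11] ->]]]]
  /set_mem[m2 [x2 [l2 [[l20 l21] ->]]]]; apply/mem_set.
(* The parameter is a complex number between 0 and 1, hence real, as the new weights must be. *)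
have [r rt] : exists r : R, t%:num = r%:C%C.
  by apply/complex_realP; rewrite realE ge0.
have r0 : 0 <= r by rewrite -real_complex_ge0 -rt ge0.
have r1 : r <= 1.
  by have : t%:num <= 1 by []; rewrite rt (lecR r 1).
(* The two families are concatenated, their weights scaled by [r] and [1 - r]. *)
exists (m1 + m2)%N,
  (fun i : 'I_(m1 + m2) =>
     match fintype.split i with inl j => x1 j | inr j => x2 j end),
  (fun i : 'I_(m1 + m2) =>
     match fintype.split i with inl j => r * l1 j | inr j => (1 - r) * l2 j end).
split.
  split=> [i|]; first by case: fintype.split => j; rewrite mulr_ge0// subr_ge0.
  rewrite big_split_ord/=.
  under eq_bigr do rewrite (unsplitK (inl _)).
  under [X in _ + X]eq_bigr do rewrite (unsplitK (inr _)).
  by rewrite -!mulr_sumr l11 l21 !mulr1 addrC subrK.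
rewrite /conv/= rt /Amx big_split_ord/= !scaler_sumr; congr (_ + _).
  by apply: eq_bigr => i _; rewrite (unsplitK (inl _)) scalerA rmorphM.
apply: eq_bigr => i _; rewrite (unsplitK (inr _)) scalerA rmorphM/=.
by rewrite rmorphB.
Qed.

End RankOneAverages.

(** * Caratheodory reduction to [N + 1] points *)

Section Caratheodory.
Variables (R : realType) (Omega : Type) (n : nat) (phi : 'I_n -> Omega -> Cplx R).
Local Notation C := (Cplx R).
Local Notation "M ^H" := (M^t*%sesqui) (at level 8, format "M ^H").

(** The rank-one matrices are Hermitian, so taking adjoints conjugates the coefficients of a
    relation; half the sum of both relations has the real parts as coefficients. *)
Lemma Re_rank1_relation m (x : 'I_m -> Omega) (c : 'I_m -> C) :
  \sum_i c i *: rank1 phi (x i) = 0 ->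
  \sum_i (complex.Re (c i))%:C%C *: rank1 phi (x i) = 0.
Proof.
move=> c0.
have cJ0 : \sum_i (c i)^* *: rank1 phi (x i) = 0.
  have := congr1 (fun M : 'M[C]_n => M^H) c0.
  rewrite linear0 map_mx0 linear_sum/= (raddf_sum (map_mx _))/=.
  by under eq_bigr do rewrite linearZ/= map_mxZ rank1_adj.
transitivity (2^-1 *: (\sum_i c i *: rank1 phi (x i) +
                       \sum_i (c i)^* *: rank1 phi (x i))).
  rewrite -big_split/= scaler_sumr; apply: eq_bigr => i _.
  by rewrite -scalerDl scalerA mulrC; congr (_ *: _); exact: ReJ_add.
by rewrite c0 cJ0 addr0 scaler0.
Qed.

Lemma Re_sum_relation m (c : 'I_m -> C) :
  \sum_i c i = 0 -> \sum_i complex.Re (c i) = 0.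
Proof.
move=> c0; have := congr1 (@complex.Re R) c0.
by rewrite (raddf_sum (@complex.Re R : {additive C -> R})).
Qed.

Lemma complex_relation (N k : nat) (x : 'I_k.+1 -> Omega) :
  has_dim (lin_span (fun (kl : 'I_n * 'I_n) (x : Omega) =>
                       phi kl.1 x * (phi kl.2 x)^* )) N ->
  (N < k)%N ->
  exists c : 'I_k.+1 -> C, [/\ exists i, c i != 0, \sum_i c i = 0 &
    \sum_i c i *: rank1 phi (x i) = 0].
Proof.
move=> [e [_ span_e]] Nk.
(* The [k + 1] coefficients face [N + 1] linear conditions: one for each [e j], and one, from the
   column of ones, for the zero sum. As [N < k], a nonzero solution exists. *)
pose E : 'M[C]_(k.+1, N + 1) := row_mx (\matrix_(i, j) e j (x i)) (const_mx 1).
have : kermx E != 0.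
  rewrite -mxrank_eq0 mxrank_ker -lt0n subn_gt0 (leq_ltn_trans (rank_leq_col _))//.
  by rewrite addn1 ltnS.
case/rowV0Pn => c /sub_kermxP cE c0; exists (c 0).
have [cEl cEr] : c *m (\matrix_(i, j) e j (x i)) = 0 /\ c *m const_mx 1 = 0 :> 'rV_1.
  by apply: eq_row_mx; rewrite -mul_mx_row cE row_mx0.
split.
- by apply/existsP; apply: contraNT c0; rewrite negb_exists => /forallP h;
    apply/eqP/rowP => i; rewrite mxE; apply/eqP; have := h i; rewrite negbK.
- move/matrixP: cEr => /(_ 0 0); rewrite !mxE => e0; rewrite -[RHS]e0.
  by apply: eq_bigr => i _; rewrite mxE mulr1.
apply/matrixP => p q; rewrite summxE mxE.
(* The [(p, q)] entry of [rank1] is one of the spanning products, hence a combination of the [e j],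
   whose weighted sums over the points vanish. *)
have [a pq] : lin_span e (fun x => phi p x * (phi q x)^* ).
  rewrite span_e; exists (fun kl => (kl == (p, q))%:R).
  rewrite (bigD1 (p, q))//= eqxx scale1r big1 ?addr0// => kl /negbTE ->.
  by rewrite scale0r.
transitivity (\sum_j a j * (c *m (\matrix_(i, j) e j (x i))) 0 j); last first.
  by rewrite cEl big1// => j _; rewrite mxE mulr0.
under [RHS]eq_bigr do rewrite mxE mulr_sumr.
rewrite exchange_big/=; apply: eq_bigr => i _.
rewrite !mxE big_ord1 !mxE.
have -> : phi p (x i) * (phi q (x i))^* = \sum_j a j * e j (x i).
  have := congr1 (@^~ (x i)) pq; rewrite /= => ->.
  by rewrite fct_sumE.
by rewrite mulr_sumr; apply: eq_bigr => j _; rewrite !mxE mulrCA.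
Qed.

Lemma real_relation (N k : nat) (x : 'I_k.+1 -> Omega) :
  has_dim (lin_span (fun (kl : 'I_n * 'I_n) (x : Omega) =>
                       phi kl.1 x * (phi kl.2 x)^* )) N ->
  (N < k)%N ->
  exists c : 'I_k.+1 -> R, [/\ exists i, c i != 0, \sum_i c i = 0 &
    \sum_i (c i)%:C%C *: rank1 phi (x i) = 0].
Proof.
move=> dimN Nk; have [c [[i0 ci0] c0 cr0]] := complex_relation N k x dimN Nk.
have [Re0|Re_neq0] := eqVneq (complex.Re (c i0)) 0; last first.
  exists (fun i => complex.Re (c i)); split.
  - by exists i0.
  - exact: Re_sum_relation.
  - exact: Re_rank1_relation.
(* c i0 is purely imaginary and nonzero, so 'i * c has a nonzero real part. *)
exists (fun i => complex.Re ('i%C * c i)); split.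
- exists i0; apply: contra ci0; rewrite mulrC ReiNIm oppr_eq0 => Im0.
  by rewrite eq_complex Re0 eqxx Im0.
- by apply: Re_sum_relation; rewrite -mulr_sumr c0 mulr0.
- apply: Re_rank1_relation; under eq_bigr do rewrite -scalerA.
  by rewrite -scaler_sumr cr0 scaler0.
Qed.

(** The weights move along the relation, which changes neither their sum nor the matrix, until the
    first of them reaches zero. *)
Lemma remove_point (k : nat) (x : 'I_k.+1 -> Omega) (lam c : 'I_k.+1 -> R) :
  prob_weights lam -> (exists i, c i != 0) -> \sum_i c i = 0 ->
  \sum_i (c i)%:C%C *: rank1 phi (x i) = 0 ->
  exists (y : 'I_k -> Omega) (mu : 'I_k -> R),
    prob_weights mu /\ Amx phi y mu = Amx phi x lam.
Proof.
move=> [l0 l1] [i ci] c0 cr0.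
have [j cj] : exists j, 0 < c j.
  apply: contrapT => cle.
  have {}cle i' : 0 <= - c i'.
    by rewrite oppr_ge0 leNgt; apply/negP => ?; apply: cle; exists i'.
  have : \sum_i (- c i) == 0 by rewrite sumrN c0 oppr0.
  rewrite psumr_eq0// => /allP/(_ i); rewrite mem_index_enum => /(_ isT)/=.
  by rewrite oppr_eq0 (negbTE ci).
(* The least ratio [lam i / c i] over positive [c i] is the largest step that keeps all weights
   nonnegative; it annihilates the weight at [i0]. *)
case: (@arg_minP _ _ _ j (fun j => 0 < c j) (fun j => lam j / c j) cj) => i0 ci0 i0min.
pose t := lam i0 / c i0.
pose nu i := lam i - t * c i.
have nu0 : nu i0 = 0 by rewrite /nu /t divfK ?subrr// gt_eqF.
have nu_ge0 i' : 0 <= nu i'.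
  rewrite /nu subr_ge0; have [ci'|ci'] := ltP 0 (c i').
    by rewrite -ler_pdivlMr//; exact: i0min.
  by rewrite (le_trans _ (l0 i'))// mulr_ge0_le0// divr_ge0// ltW.
exists (x \o lift i0), (nu \o lift i0); split.
  split=> [i'|]; first exact: nu_ge0.
  have : \sum_i nu i = 1 by rewrite sumrB -mulr_sumr c0 mulr0 subr0.
  by rewrite (bigD1_ord i0)//= nu0 add0r.
rewrite /Amx.
transitivity (\sum_i ((nu i)%:C%C : C) *: rank1 phi (x i)).
  by rewrite [RHS](bigD1_ord i0)//= nu0 scale0r add0r.
transitivity (\sum_i ((lam i)%:C%C : C) *: rank1 phi (x i) -
   t%:C%C *: \sum_i ((c i)%:C%C : C) *: rank1 phi (x i)).
  rewrite scaler_sumr -sumrB; apply: eq_bigr => i' _.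
  by rewrite scalerA -scalerBl rmorphB rmorphM.
by rewrite cr0 scaler0 subr0.
Qed.

(** The first point is repeated with weight 0. It exists, since an empty family of weights cannot
    sum to 1. *)
Lemma pad_weights m m' (x : 'I_m -> Omega) (lam : 'I_m -> R) : (m <= m')%N ->
  prob_weights lam ->
  exists (y : 'I_m' -> Omega) (mu : 'I_m' -> R),
    prob_weights mu /\ Amx phi y mu = Amx phi x lam.
Proof.
case: m x lam => [|m] x lam mm' [l0 l1].
  by move: l1; rewrite big_ord0 => /esym/eqP; rewrite oner_eq0.
rewrite -(subnKC mm').
exists (fun i : 'I_(m.+1 + (m' - m.+1)) =>
          match fintype.split i with inl j => x j | inr _ => x ord0 end),
       (fun i : 'I_(m.+1 + (m' - m.+1)) =>
          match fintype.split i with inl j => lam j | inr _ => 0 end).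
split.
  split=> [i|]; first by case: fintype.split.
  rewrite big_split_ord/=.
  under eq_bigr do rewrite (unsplitK (inl _)).
  under [X in _ + X]eq_bigr do rewrite (unsplitK (inr _)).
  by rewrite big1_eq addr0.
rewrite /Amx big_split_ord/=.
under eq_bigr do rewrite (unsplitK (inl _)).
under [X in _ + X]eq_bigr do rewrite (unsplitK (inr _)) scale0r.
by rewrite big1_eq addr0.
Qed.

Lemma caratheodory_Amx (N m : nat) (x : 'I_m -> Omega) (lam : 'I_m -> R) :
  has_dim (lin_span (fun (kl : 'I_n * 'I_n) (x : Omega) =>
                       phi kl.1 x * (phi kl.2 x)^* )) N ->
  prob_weights lam ->
  exists (y : 'I_N.+1 -> Omega) (mu : 'I_N.+1 -> R),
    prob_weights mu /\ Amx phi y mu = Amx phi x lam.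
Proof.
move=> dimN; elim: m x lam => [|m IH] x lam pl.
  exact: pad_weights pl.
have [mN|Nm] := leqP m.+1 N.+1; first exact: pad_weights pl.
have [c [c0 cs0 cr0]] := real_relation N m x dimN Nm.
have [y [mu [pmu <-]]] := remove_point m x lam c pl c0 cs0 cr0.
exact: IH.
Qed.

End Caratheodory.

(** * Continuity of complex-valued maps and of the determinant *)

Section ComplexContinuity.
Variable R : realType.
Local Notation C := (Cplx R).

Lemma continuous_real_complex : continuous (fun a : R => a%:C%C : C).
Proof.
move=> a; apply/cvgrPdist_lt => e e0.
(* A positive element of [C] is real, so the radius may be taken in [R]. *)
have [er _] : e = (complex.Re e)%:C%C /\ True.
  by split=> //; rewrite RRe_real// ger0_real// ltW.
have re0 : 0 < complex.Re e by move: e0; rewrite {1}er ltcR.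
near=> b; rewrite er -rmorphB/= normc_def/= expr0n/= addr0 sqrtr_sqr.
rewrite ltcR; near: b; exact: cvgr_dist_lt.
Unshelve. all: by end_near. Qed.

Lemma continuous_Re : continuous (@complex.Re R : C -> R).
Proof.
move=> z; apply/(cvgrPdist_lt (FF := nbhs_filter z)) => e e0.
have e0' : 0 < (e%:C%C : C) by rewrite ltcR.
have zw : \forall w \near z, `|z - w| < (e%:C%C : C).
  exact: (@cvgr_dist_lt C C _ (nbhs z) _ id z).
apply: filterS zw => w; rewrite -raddfB/= -ltcR.
exact/le_lt_trans/normc_ge_Re.
Qed.

Lemma continuous_conj : continuous (Num.conj : C -> C).
Proof.
move=> z; apply/(cvgrPdist_lt (FF := nbhs_filter z)) => e e0.
have zw : \forall w \near z, `|z - w| < e.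
  exact: (@cvgr_dist_lt C C _ (nbhs z) _ id z).
by apply: filterS zw => w; rewrite -rmorphB/= norm_conjC.
Qed.

Lemma continuous_mul (T : topologicalType) (f g : T -> C) :
  continuous f -> continuous g -> continuous (fun t => f t * g t).
Proof. by move=> cf cg t; apply: cvgM; [exact: cf|exact: cg]. Qed.

Lemma continuous_big_prod (T : topologicalType) (I : Type) (r : seq I) (P : pred I)
    (f : I -> T -> C) : (forall i, continuous (f i)) ->
  continuous (fun t => \prod_(i <- r | P i) f i t).
Proof.
move=> cf; elim: r => [|i r IH] t.
  by under eq_fun do rewrite big_nil; exact: cvg_cst.
under eq_fun do rewrite big_cons.
case: (P i); last exact: IH.
by apply: cvgM; [exact: cf|exact: IH].
Qed.

Lemma continuous_big_sum (T : topologicalType) (I : Type) (r : seq I) (P : pred I)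
    (K : numFieldType) (V : normedModType K) (f : I -> T -> V) :
  (forall i, continuous (f i)) ->
  continuous (fun t => \sum_(i <- r | P i) f i t).
Proof.
move=> cf; elim: r => [|i r IH] t.
  by under eq_fun do rewrite big_nil; exact: cvg_cst.
under eq_fun do rewrite big_cons.
case: (P i); last exact: IH.
by apply: cvgD; [exact: cf|exact: IH].
Qed.

Lemma continuous_det (T : topologicalType) n (M : T -> 'M[C]_n) :
  (forall i j, continuous (fun t => M t i j)) -> continuous (fun t => \det (M t)).
Proof.
move=> cM; rewrite /determinant; apply: continuous_big_sum => s t.
by apply: cvgM; [exact: cvg_cst|apply: continuous_big_prod].
Qed.

End ComplexContinuity.

(** * Existence of a maximizing configuration with a fixed number of points *)

Section Existence.
Variables (R : realType) (Omega : topologicalType) (n m : nat).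
Variable (phi : 'I_n -> Omega -> Cplx R).
Hypothesis cptOmega : compact [set: Omega].
Hypothesis cont_phi : forall k, continuous (phi k).
Local Notation C := (Cplx R).

(** A single element of [T] encodes all points together with their weights. *)
Let T := prod_topology (fun _ : 'I_m => (Omega * R)%type).
Let pts (f : T) i := (f i).1.
Let wts (f : T) i := (f i).2.

Let continuous_pts i : continuous (fun f : T => pts f i).
Proof.
move=> f; apply: (@continuous_comp _ _ _ (fun f : T => f i) fst).
  exact: proj_continuous.
exact: cvg_fst.
Qed.

Let continuous_phi_pts i k : continuous (fun f : T => phi k (pts f i)).
Proof.
move=> f; apply: (@continuous_comp _ _ _ (fun f : T => pts f i) (phi k)).
  exact: continuous_pts.
exact: cont_phi.
Qed.

Let continuous_wts i : continuous (fun f : T => wts f i).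
Proof.
move=> f; apply: (@continuous_comp _ _ _ (fun f : T => f i) snd).
  exact: proj_continuous.
exact: cvg_snd.
Qed.

Let continuous_Amx p q : continuous (fun f : T => Amx phi (pts f) (wts f) p q).
Proof.
have -> : (fun f : T => Amx phi (pts f) (wts f) p q) = (fun f : T =>
    \sum_i (wts f i)%:C%C * (phi p (pts f i) * (phi q (pts f i))^* )).
  by apply/funext => f; rewrite summxE; apply: eq_bigr => i _;
    rewrite !mxE big_ord1 !mxE.
apply: continuous_big_sum => i; apply: continuous_mul.
  move=> f; apply: (@continuous_comp _ _ _ (fun f : T => wts f i)
    (fun a => a%:C%C : C)).
    exact: continuous_wts.
  exact: continuous_real_complex.
apply: continuous_mul; first exact: continuous_phi_pts.
move=> f; apply: (@continuous_comp _ _ _ (fun f : T => phi q (pts f i)) Num.conj).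
  exact: continuous_phi_pts.
exact: continuous_conj.
Qed.

(** The extreme value theorem on a compact set of configurations, nonempty thanks to [lam0]. Real
    parts make the objective real-valued; nothing is lost, as these determinants are real. *)
Lemma max_det_Amx (x0 : 'I_m -> Omega) (lam0 : 'I_m -> R) : prob_weights lam0 ->
  exists (x : 'I_m -> Omega) (lam : 'I_m -> R), prob_weights lam /\
  forall (y : 'I_m -> Omega) (mu : 'I_m -> R), prob_weights mu ->
    complex.Re (\det (Amx phi y mu)) <= complex.Re (\det (Amx phi x lam)).
Proof.
move=> pl0.
pose g (f : T) : R := complex.Re (\det (Amx phi (pts f) (wts f))).
have cg : continuous g.
  move=> f; apply: (@continuous_comp _ _ _
    (fun f : T => \det (Amx phi (pts f) (wts f)) : C) (@complex.Re R)).
    exact: continuous_det.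
  exact: continuous_Re.
(* Weights summing to 1 lie in [[0, 1]], so the configurations form a closed part of a product that
   is compact by Tychonoff. *)
pose box := [set f : T | forall i, (setT `*` `[0, 1]%classic) (f i)].
pose K := box `&` [set f : T | \sum_i wts f i = 1].
have cK : compact K.
  apply: compact_closedI.
    apply: (@tychonoff 'I_m (fun=> (Omega * R)%type : topologicalType)
      (fun=> setT `*` `[0, 1]%classic)) => i.
    exact: (compact_setX cptOmega (@segment_compact R 0 1)).
  rewrite (_ : [set f | _] = (fun f => \sum_i wts f i) @^-1` [set 1])//.
  apply: preimage_closed => [f _|]; last exact: closed_eq.
  exact: (continuous_big_sum _ _ _ _ R R).
have KP (y : 'I_m -> Omega) (mu : 'I_m -> R) : prob_weights mu ->
    K (fun i => (y i, mu i)).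
  move=> [mu0 mu1]; split=> // i; split=> //=; rewrite in_itv/= mu0/=.
  by rewrite -mu1 (bigD1 i)//= lerDl sumr_ge0.
have [|f fK fmax] := compact_EVT_max _ cK (continuous_subspaceT cg).
  by exists (fun i => (x0 i, lam0 i)); exact: KP.
have [fbox f1] := set_mem fK.
exists (pts f), (wts f); split.
  split=> // i; have [_] := fbox i; by rewrite /= in_itv/= => /andP[].
move=> y mu pmu; exact: (fmax _ (mem_set (KP y mu pmu))).
Qed.

End Existence.

(** * A scalar inequality for the bound on [psi] *)

Lemma bernoulli_1B (R : realFieldType) (n : nat) (t : R) : 0 <= t <= 1 ->
  1 - n%:R * t <= (1 - t) ^+ n.
Proof.
move=> /andP[t0 t1]; elim: n => [|n IH]; first by rewrite mul0r subr0.
rewrite exprS; apply: (@le_trans _ _ ((1 - t) * (1 - n%:R * t))).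
  have : 0 <= n%:R * (t * t) by rewrite !mulr_ge0.
  by rewrite -[n.+1%:R]natr1; nra.
by rewrite ler_wpM2l// subr_ge0.
Qed.

(** To first order in [t] the left side is [1 + t * (s - n)], which exceeds 1 for small [t] if
    [s > n]. *)
Lemma le_nat_of_expr_bound (R : realFieldType) (n : nat) (s : R) :
  (0 < n)%N -> 0 <= s ->
  (forall t, 0 < t < 1 -> (1 - t) ^+ n * (1 + t * s) <= 1) -> s <= n%:R.
Proof.
move=> n0 s0 H; rewrite leNgt; apply/negP => ns.
have n1 : 0 < n%:R :> R by rewrite ltr0n.
have sp : 0 < s by rewrite (lt_trans n1).
have n1' : 1 <= n%:R :> R by rewrite ler1n.
(* By Bernoulli, s - n <= n t s; this t makes the right side (s - n) / 2. *)
pose t := (s - n%:R) / (2 * n%:R * s).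
have d0 : 0 < 2 * n%:R * s by rewrite !mulr_gt0.
have tE : t * (2 * n%:R * s) = s - n%:R by rewrite divfK// gt_eqF.
have t0 : 0 < t by rewrite divr_gt0// subr_gt0.
have t1 : t < 1 by rewrite ltr_pdivrMr// mul1r; nra.
have := H t; rewrite t0 t1 => /(_ isT) h.
have b : 1 - n%:R * t <= (1 - t) ^+ n by apply: bernoulli_1B; rewrite !ltW.
have ts : 0 <= 1 + t * s by rewrite addr_ge0// mulr_ge0// ltW.
have {}h : (1 - n%:R * t) * (1 + t * s) <= 1.
  by apply: le_trans h; exact: ler_wpM2r.
have : t * (s - n%:R - n%:R * t * s) <= 0 by nra.
rewrite pmulr_rle0//; nra.
Qed.

(** * Nonsingular averages and the properties of a maximizer *)

Section Optimality.
Variables (R : realType) (Omega : Type) (n : nat) (phi : 'I_n -> Omega -> Cplx R).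
Local Notation C := (Cplx R).
Local Notation "M ^H" := (M^t*%sesqui) (at level 8, format "M ^H").
Local Notation u := (phivec phi).

(** With fewer than [n] rows some nonzero [v] is annihilated by all of them. The function with
    coefficients [v] is not identically zero, and a point [y] where it does not vanish gives a
    further independent row. *)
Lemma lin_indep_row_free (k : nat) : lin_indep phi -> (k <= n)%N ->
  exists x : 'I_k -> Omega, row_free (\matrix_(i < k, j < n) phi j (x i)).
Proof.
move=> indep; elim: k => [_|k IH kn].
  have x : 'I_0 -> Omega by case.
  by exists x; rewrite /row_free flatmx0 mxrank0.
have [x xfree] := IH (ltnW kn).
set A := (X in row_free X) in xfree.
have : kermx A^T != 0.
  rewrite -mxrank_eq0 mxrank_ker mxrank_tr -lt0n subn_gt0.
  by rewrite (leq_ltn_trans (rank_leq_row _)).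
case/rowV0Pn => v /sub_kermxP vA v0.
have [y vy] : exists y, \sum_j v 0 j * phi j y != 0.
  apply: contrapT => vphi; move/eqP: v0; apply; apply/rowP => j; rewrite mxE.
  apply: indep; apply/funext => y; rewrite fct_sumE; apply/eqP.
  by apply: contrapT => /negP vy; apply: vphi; exists y.
pose a : 'rV[C]_n := \row_j phi j y.
have Afree : row_free (col_mx A a).
  rewrite -kermx_eq0; apply/rowV0P => w /sub_kermxP.
  rewrite -[w]hsubmxK mul_row_col => wA.
  (* Multiplying the relation by [v^T] kills the old rows and isolates the coefficient of the new
     one. *)
  have := congr1 (mulmxr v^T) wA.
  rewrite /= mul0mx mulmxDl -!mulmxA.
  have -> : A *m v^T = 0 by rewrite -[A]trmxK -trmx_mul vA trmx0.
  rewrite mulmx0 add0r => /matrixP/(_ 0 0).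
  rewrite !mxE big_ord1 => /eqP; rewrite mulf_eq0.
  have -> : (a *m v^T) 0 0 == 0 = false.
    apply/negbTE; apply: contra vy => /eqP e0; apply/eqP; rewrite -[RHS]e0 mxE.
    by apply: eq_bigr => j _; rewrite !mxE mulrC.
  rewrite orbF => /eqP w0; move: wA.
  have -> : rsubmx w = 0 by apply/rowP => i; rewrite !ord1 w0 mxE.
  rewrite mul0mx addr0 => /eqP; rewrite mulmx_free_eq0// => /eqP ->.
  by rewrite row_mx0.
rewrite -addn1.
exists (fun i : 'I_(k + 1) => match fintype.split i with inl j => x j | inr _ => y end).
apply: etrans Afree; congr row_free; apply/matrixP => i j.
by rewrite !mxE; case: fintype.split => i'; rewrite !mxE.
Qed.

(** Uniform weights on the [n] points found above give [W^T] times the conjugate of [W], up to the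
    factor [1 / n], with [W] invertible. *)
Lemma exists_Amx_det_neq0 : (0 < n)%N -> lin_indep phi ->
  exists (x : 'I_n -> Omega) (lam : 'I_n -> R),
    prob_weights lam /\ \det (Amx phi x lam) != 0.
Proof.
move=> n0 indep; have [x xfree] := lin_indep_row_free n indep (leqnn n).
set W := (X in row_free X) in xfree.
exists x, (fun=> n%:R^-1); split.
  split=> [i|]; first by rewrite invr_ge0.
  by rewrite sumr_const card_ord -[LHS]mulr_natr mulVf// pnatr_eq0 -lt0n.
have -> : Amx phi x (fun=> n%:R^-1) =
    (n%:R^-1)%:C%C *: (W^T *m map_mx Num.conj W).
  rewrite /Amx -scaler_sumr; congr (_ *: _); apply/matrixP => p q.
  rewrite summxE !mxE; apply: eq_bigr => i _.
  by rewrite !mxE big_ord1 !mxE.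
rewrite detZ det_mulmx det_tr det_map_mx !mulf_neq0//.
- by rewrite expf_neq0// fmorph_eq0 invr_eq0 pnatr_eq0 -lt0n.
- by rewrite -unitfE -unitmxE -row_free_unit.
- by rewrite fmorph_eq0 -unitfE -unitmxE -row_free_unit.
Qed.

Section Maximizer.
Variables (m : nat) (x : 'I_m -> Omega) (lam : 'I_m -> R).
Hypotheses (n_gt0 : (0 < n)%N) (indep : lin_indep phi).
Hypothesis plam : prob_weights lam.
Local Notation A := (Amx phi x lam).
Hypothesis Amax : forall M : 'M[C]_n,
  conv_hull (range (rank1 phi)) M -> \det M <= \det A.

Lemma maximizer_posdef : posdefmx A.
Proof.
have [y [mu [pmu detM]]] := exists_Amx_det_neq0 n_gt0 indep.
apply: psd_posdefmx; first exact: Amx_herm.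
  by move=> a; apply: Amx_psd; case: plam.
have /Amax : conv_hull (range (rank1 phi)) (Amx phi y mu).
  by apply/conv_hull_rank1P; exists n, y, mu.
move=> detMA; rewrite gt_eqF//; apply: lt_le_trans detMA; rewrite lt_def detM/=.
apply: psd_det_ge0; first exact: Amx_herm.
by move=> a; apply: Amx_psd; case: pmu.
Qed.

(** The Hermitian factor [invsqrtmx A] moves onto [a], which leaves the quadratic form of [A] at
    [invsqrtmx A *m a]. *)
Lemma maximizer_frame (a : 'cV[C]_n) :
  \sum_i (lam i)%:C%C * `|inner a (psi phi x lam (x i))| ^+ 2 = norm2 a ^+ 2.
Proof.
have Apos := maximizer_posdef.
have psiE i : inner a (psi phi x lam (x i)) = inner (invsqrtmx A *m a) (u (x i)).
  by rewrite !innerE trmxCM (invsqrtmx_herm _ _ _ Apos) mulmxA.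
under eq_bigr do rewrite psiE.
by rewrite -inner_Amx inner_invsqrtmx.
Qed.

Local Notation s y := (inner (psi phi x lam y) (psi phi x lam y)).

Let sE y : s y = ((u y)^H *m invmx A *m u y) 0 0.
Proof.
by rewrite -norm2_invsqrt_sqr ?sqrtCK//; exact: maximizer_posdef.
Qed.

Lemma maximizer_inner_le y : s y <= n%:R.
Proof.
have Apos := maximizer_posdef.
have Au := posdef_unitmx _ _ _ Apos.
have s0 : 0 <= s y by exact: inner_ge0.
have sR : s y = (complex.Re (s y))%:C%C by rewrite RRe_real// ger0_real.
rewrite sR -(rmorph_nat (real_complex R)) lecR.
apply: le_nat_of_expr_bound => //.
  by rewrite -real_complex_ge0 -sR.
move=> t /andP[t0 t1].
have t0C : 0 <= (t%:C%C : C) by rewrite real_complex_ge0 ltW.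
have t1C : (t%:C%C : C) <= 1 by rewrite (lecR t 1) ltW.
have hull : conv_hull (range (rank1 phi)) (t%:C%C *: rank1 phi y + (1 - t%:C%C) *: A).
  move=> B [cB rB].
  have /mem_set By : B (rank1 phi y) by apply: rB; exists y.
  have /mem_set BA : B A.
    have /conv_hull_rank1P : exists k (z : 'I_k -> Omega) mu,
      prob_weights mu /\ A = Amx phi z mu by exists m, x, lam.
    by apply; split.
  exact: set_mem (cB _ _ (Itv01 t0C t1C) By BA).
have detA : 0 < \det A.
  rewrite lt_def -unitfE -unitmxE Au; apply: psd_det_ge0; first exact: Amx_herm.
  by move=> a; apply: Amx_psd; case: plam.
have q0 : 0 < 1 - t by rewrite subr_gt0.
have q0C : 0 < 1 - (t%:C%C : C) by rewrite -(rmorphB (real_complex R) 1) (ltcR 0).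
have := Amax _ hull.
(* Factoring out [1 - t] exposes a rank-one update of [A]; its determinant is then compared with
   that of [A], which is positive and cancels. *)
have -> : t%:C%C *: rank1 phi y + (1 - t%:C%C) *: A =
    (1 - t%:C%C) *: (A + (t%:C%C / (1 - t%:C%C)) *: (u y *m (u y)^H)).
  by rewrite scalerDr scalerA mulrCA mulfV ?gt_eqF// mulr1 addrC.
rewrite detZ det_rank1_update// -sE mulrCA -[leRHS]mulr1 (ler_pM2l detA) => h.
have {}h : ((1 - t) ^+ n * (1 + t / (1 - t) * complex.Re (s y)))%:C%C <= 1%:C%C :> C.
  apply: le_trans h; rewrite {2}sR.
  by rewrite !(rmorphM, rmorphXn, rmorphD, rmorphN, fmorphV, rmorph1)/=.
(* Replacing [t / (1 - t)] by the smaller [t] only lowers the left side and gives the form of the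
   scalar bound. *)
move: h; rewrite lecR; apply: le_trans.
rewrite ler_wpM2l ?exprn_ge0 ?(ltW q0)// lerD2l ler_wpM2r//.
  by rewrite -real_complex_ge0 -sR.
by rewrite ler_pdivlMr//; apply: ler_piMr; rewrite ?gerBl ltW.
Qed.

Lemma maximizer_sum_inner : \sum_i (lam i)%:C%C * s (x i) = n%:R.
Proof.
have Au := posdef_unitmx _ _ _ maximizer_posdef.
rewrite -(mxtrace1 C n) -(mulVmx Au) {2}/A /Amx mulmx_sumr raddf_sum/=.
apply: eq_bigr => i _; rewrite sE -scalemxAr mxtraceZ; congr (_ * _).
by rewrite -trace_mx11 -mulmxA mxtrace_mulC mulmxA.
Qed.

(** The weighted defects [n - s (x i)] are nonnegative and sum to zero, so each one with positive
    weight vanishes. *)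
Lemma maximizer_inner_eq y : supp x lam y -> s y = n%:R.
Proof.
move=> [i /= li <-]; apply/eqP; rewrite -subr_eq0 -oppr_eq0 opprB.
have ge0 j : 0 <= (lam j)%:C%C * (n%:R - s (x j)).
  by rewrite mulr_ge0 ?real_complex_ge0 ?subr_ge0 ?maximizer_inner_le//;
    case: plam.
have : \sum_i (lam i)%:C%C * (n%:R - s (x i)) == 0.
  under eq_bigr do rewrite mulrBr.
  rewrite sumrB maximizer_sum_inner -mulr_suml sum_real_complex.
  by case: plam => _ ->; rewrite mul1r subrr.
rewrite psumr_eq0// => /allP/(_ i); rewrite mem_index_enum => /(_ isT)/=.
by rewrite mulf_eq0 (fmorph_eq0 (real_complex R)) gt_eqF.
Qed.

End Maximizer.
End Optimality.

Theorem theorem3p5 (R : realType) (Omega : topologicalType) (n N : nat)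
    (phi : 'I_n -> Omega -> Cplx R)
    (n_gt0 : (0 < n)%N)
    (cptOmega : compact [set: Omega])
    (cont_phi : forall k, continuous (phi k))
    (indep_phi : lin_indep phi)
    (dimN : has_dim
       (lin_span (fun (kl : 'I_n * 'I_n) (x : Omega) =>
                    phi kl.1 x * (phi kl.2 x)^* ))
       N) :
  let detmax := is_max (fun M : 'M[Cplx R]_n => \det M)
                  (conv_hull (range (rank1 phi))) in
  (exists (x : 'I_N.+1 -> Omega) (lam : 'I_N.+1 -> R),
      prob_weights lam /\ detmax (\det (Amx phi x lam))) /\
  (forall (x : 'I_N.+1 -> Omega) (lam : 'I_N.+1 -> R),
      prob_weights lam -> detmax (\det (Amx phi x lam)) ->
      [/\ posdefmx (Amx phi x lam),
          forall a : 'cV[Cplx R]_n,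
            \sum_i (lam i)%:C%C * `|inner a (psi phi x lam (x i))| ^+ 2
            = norm2 a ^+ 2,
          forall y : Omega, norm2 (psi phi x lam y) <= sqrtC n%:R &
          forall y : Omega, supp x lam y ->
            norm2 (psi phi x lam y) = sqrtC n%:R]).
Proof.
move=> detmax; split=> [|x lam plam [_ detA_max]]; last first.
  have Amax M : conv_hull (range (rank1 phi)) M -> \det M <= \det (Amx phi x lam).
    exact: detA_max.
  split.
  - exact: maximizer_posdef.
  - exact: maximizer_frame.
  - move=> y; rewrite ler_sqrtC ?qualifE/= ?inner_ge0 ?ler0n//.
    exact: maximizer_inner_le.
  - move=> y ysupp; congr sqrtC.
    exact: (maximizer_inner_eq _ _ _ _ _ _ _ n_gt0 indep_phi plam Amax y ysupp).
(* Determinants of averages are real, so comparing their real parts suffices for the order of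
   [C]. *)
have det_real m (y : 'I_m -> Omega) (mu : 'I_m -> R) : prob_weights mu ->
    \det (Amx phi y mu) = (complex.Re (\det (Amx phi y mu)))%:C%C.
  move=> [mu0 _]; rewrite RRe_real// ger0_real// psd_det_ge0//.
    exact: Amx_herm.
  by move=> a; exact: Amx_psd.
have [x0 [lam0 [plam0 _]]] := exists_Amx_det_neq0 _ _ _ _ n_gt0 indep_phi.
have [x1 [lam1 [plam1 _]]] := caratheodory_Amx _ _ _ _ N _ x0 lam0 dimN plam0.
have [x [lam [plam xmax]]] := max_det_Amx _ _ _ _ _ cptOmega cont_phi x1 lam1 plam1.
exists x, lam; split=> //; split.
  exists (Amx phi x lam) => //; apply/conv_hull_rank1P.
  by exists N.+1, x, lam.
(* Any matrix of the hull is also an average over [N + 1] points, where [xmax] applies. *)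
move=> _ /conv_hull_rank1P[m [y [mu [pmu ->]]]].
have [z [nu [pnu <-]]] := caratheodory_Amx _ _ _ _ N _ y mu dimN pmu.
by rewrite (det_real _ _ _ pnu) (det_real _ _ _ plam) lecR xmax.
Qed.
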